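(* Let $\Omega_A$ and $\Omega_B$ be finite sets, and let $\psi:\Omega_A\times\Omega_B\to\mathbb{C}$ be normalized, i.e. $\sum_{x\in\Omega_A,\,y\in\Omega_B}|\psi(x,y)|^2=1$. For a local context pair $(U,V)$, that is, a unitary matrix $U=[U(x'\mid x)]_{x',x\in\Omega_A}$ and a unitary matrix $V=[V(y'\mid y)]_{y',y\in\Omega_B}$, define the transformed joint state $$\psi'(x',y')=\sum_{x\in\Omega_A}\sum_{y\in\Omega_B}U(x'\mid x)\,V(y'\mid y)\,\psi(x,y),\qquad x'\in\Omega_A,\ y'\in\Omega_B.$$ Then the following statements are equivalent: (i) $\psi$ is potentiality independent: there exist normalized functions $\alpha:\Omega_A\to\mathbb{C}$ and $\beta:\Omega_B\to\mathbb{C}$ such that $\psi(x,y)=\alpha(x)\beta(y)$ for all $x\in\Omega_A$, $y\in\Omega_B$; (ii) for every local context pair $(U,V)$, the Born distribution of the transformed state factorizes into its incoherent marginals: for all $x'\in\Omega_A$ and $y'\in\Omega_B$, $$|\psi'(x',y')|^2=p'_X(x')\,p'_Y(y'),$$ where $p'_X(x')=\sum_{y'\in\Omega_B}|\psi'(x',y')|^2$ and $p'_Y(y')=\sum_{x'\in\Omega_A}|\psi'(x',y')|^2$; (iii) the matrix $[\psi(x,y)]_{x\in\Omega_A,\,y\in\Omega_B}$ has rank one.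
   Context: A function $f:\Omega\to\mathbb{C}$ on a finite set $\Omega$ is called normalized (or Born-normalized; also a potentiality distribution or potentiality state) if $\sum_{\omega\in\Omega}|f(\omega)|^2=1$. The Born distribution of a normalized $f$ is $\omega\mapsto|f(\omega)|^2$. A unitary contextual transformation on a finite set $\Omega$ is a complex kernel $U(\omega'\mid\omega)$, $\omega',\omega\in\Omega$, whose matrix (row index $\omega'$, column index $\omega$) is unitary, acting on functions by $(Uf)(\omega')=\sum_{\omega}U(\omega'\mid\omega)f(\omega)$. *)

(* Defs.v *)
From mathcomp Require Import all_boot all_order all_algebra.
From mathcomp Require Import reals.
From mathcomp Require Export complex.

Set Implicit Arguments.
Unset Strict Implicit.
Unset Printing Implicit Defensive.

Import Order.TTheory GRing.Theory Num.Theory.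
Local Open Scope ring_scope.

Section Potentiality.
Variable C : numClosedFieldType.

(* The norm on C is C-valued, so Born weights and marginals are nonnegative
   real elements of C. *)
Definition born (T : finType) (f : T -> C) (t : T) : C := `|f t| ^+ 2.

Definition normalized (T : finType) (f : T -> C) : Prop :=
  \sum_(t : T) born f t = 1.

(* Matrices are indexed by ordinals, hence the enumerations of the finite
   sets; the rank and unitarity do not depend on them. *)
Definition fun_mx (S T : finType) (f : S -> T -> C) : 'M[C]_(#|S|, #|T|) :=
  \matrix_(i < #|S|, j < #|T|) f (enum_val i) (enum_val j).

(* The kernel value U(x' | x) is [U x' x]: the row index comes first. *)
Definition unitary_kernel (T : finType) (U : T -> T -> C) : Prop :=
  fun_mx U \is unitarymx.

Variables A B : finType.

Definition local_transform (U : A -> A -> C) (V : B -> B -> C)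
    (psi : A * B -> C) : A * B -> C :=
  fun p => \sum_(x : A) \sum_(y : B) U p.1 x * V p.2 y * psi (x, y).

Definition marginalX (psi : A * B -> C) (x : A) : C :=
  \sum_(y : B) born psi (x, y).

Definition marginalY (psi : A * B -> C) (y : B) : C :=
  \sum_(x : A) born psi (x, y).

Definition potentiality_independent (psi : A * B -> C) : Prop :=
  exists (alpha : A -> C) (beta : B -> C),
    [/\ normalized alpha, normalized beta
      & forall (x : A) (y : B), psi (x, y) = alpha x * beta y].

Definition born_factorizes (psi : A * B -> C) : Prop :=
  forall (x : A) (y : B), born psi (x, y) = marginalX psi x * marginalY psi y.

Definition factorizes_in_all_local_contexts (psi : A * B -> C) : Prop :=
  forall (U : A -> A -> C) (V : B -> B -> C),
    unitary_kernel U -> unitary_kernel V ->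
    born_factorizes (local_transform U V psi).

Definition state_mx (psi : A * B -> C) : 'M[C]_(#|A|, #|B|) :=
  fun_mx (fun x y => psi (x, y)).

End Potentiality.

(* Main.v *)
(** A product state stays a product under a local context pair, so its Born
    distribution factorizes.  Conversely, given [x0], [y0], [y1], put
    [u = psi (x0, y1) e_y0 - psi (x0, y0) e_y1], which is annihilated by row
    [x0] of [psi], and choose a unitary [V] having a multiple of [u] among its
    rows.  In the context [(1, V)] the transformed state then vanishes at the
    entry of row [x0] and that column; by factorization the whole row or the
    whole column vanishes.  Either way the 2x2 minors of [psi] on row [x0] and
    columns [y0], [y1] are zero, which is the rank-one condition. *)
Require Import Defs.
From mathcomp Require Import all_boot all_order all_algebra.
From mathcomp Require Import reals complex ring.

Set Implicit Arguments.
Unset Strict Implicit.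
Unset Printing Implicit Defensive.

Import Order.TTheory GRing.Theory Num.Theory.
Local Open Scope ring_scope.

Section BornWeights.
Variables (C : numClosedFieldType) (T : finType).
Implicit Types (f : T -> C) (U : T -> T -> C).

Lemma born_ge0 f t : 0 <= born f t.
Proof. by rewrite /born exprn_ge0. Qed.

Lemma born_eq0 f t : (born f t == 0) = (f t == 0).
Proof. by rewrite /born expf_eq0 normr_eq0. Qed.

Lemma sum_born_eq0 f : \sum_t born f t = 0 -> forall t, f t = 0.
Proof.
move=> /eqP; rewrite psumr_eq0 => [/allP f0 t|t _]; last exact: born_ge0.
by apply/eqP; rewrite -born_eq0; apply: f0; rewrite mem_index_enum.
Qed.

(** Membership in [unitarymx] gives orthonormal rows; a one-sided inverse of a square matrix is
    two-sided, which yields the columns. *)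
Lemma unitary_kernel_orthonormal U : unitary_kernel U ->
  forall x z, \sum_t (U t x)^* * U t z = (x == z)%:R.
Proof.
move=> /unitarymxP /mulmx1C /matrixP UU x z.
have := UU (enum_rank x) (enum_rank z).
rewrite !mxE (inj_eq enum_rank_inj) => <-.
rewrite (reindex (@enum_val T T)); last exact/onW_bij/enum_val_bij.
by apply: eq_bigr => i _; rewrite !mxE !enum_rankK.
Qed.

(** Parseval: once the squares are expanded, orthonormality of the columns leaves only the diagonal
    terms. *)
Lemma unitary_kernel_sum_born U f : unitary_kernel U ->
  \sum_t born (fun t' => \sum_x U t' x * f x) t = \sum_t born f t.
Proof.
move=> /unitary_kernel_orthonormal UU.
transitivity (\sum_t \sum_x \sum_z ((U t x)^* * U t z) * ((f x)^* * f z)).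
  apply: eq_bigr => t _; rewrite /born normCKC rmorph_sum mulr_suml.
  apply: eq_bigr => x _; rewrite mulr_sumr; apply: eq_bigr => z _.
  by rewrite rmorphM mulrACA.
rewrite exchange_big; apply: eq_bigr => x _; rewrite exchange_big /=.
under eq_bigr => z _ do rewrite -mulr_suml UU.
rewrite (bigD1 x) //= big1 ?addr0 => [|z]; last first.
  by rewrite eq_sym => /negbTE->; rewrite mul0r.
by rewrite eqxx mul1r /born normCKC.
Qed.

Lemma unitary_kernel_id : unitary_kernel (fun t t' : T => (t == t')%:R : C).
Proof.
rewrite /unitary_kernel.
have -> : fun_mx (fun t t' : T => (t == t')%:R : C) = 1%:M.
  by apply/matrixP => i j; rewrite !mxE (inj_eq enum_val_inj).
by apply/unitarymxP; rewrite trmx1 map_mx1 mulmx1.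
Qed.

(* Gram-Schmidt: the first row of [schmidt A] spans the first row of [A]. *)
Lemma unitary_kernel_with_row (u : T -> C) (t0 : T) :
  exists V c t1, unitary_kernel V /\ forall t, u t = c * V t1 t.
Proof.
have T_gt0 : (0 < #|T|)%N by apply/card_gt0P; exists t0.
pose i0 := Ordinal T_gt0.
(* Every row is [u], possibly zero; [schmidt A] is unitary whatever the rank of [A]. *)
pose A : 'M[C]_#|T| := \matrix_(i, j) u (enum_val j).
have /sub_rVP[c Ac] : (row i0 A <= row i0 (schmidt A))%MS.
  apply: submx_trans (row_schmidt_sub A i0) _.
  apply/sumsmx_subP => k; rewrite leqn0 => /eqP k0.
  by rewrite genmxE (_ : k = i0) //; apply: val_inj.
exists (fun t t' => schmidt A (enum_rank t) (enum_rank t')), c, (enum_val i0).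
split=> [|t].
  rewrite /unitary_kernel (_ : fun_mx _ = schmidt A) ?schmidt_unitarymx //.
  by apply/matrixP => i j; rewrite !mxE !enum_valK.
by move/rowP/(_ (enum_rank t)): Ac; rewrite !mxE enum_rankK enum_valK.
Qed.

End BornWeights.

Section JointStates.
Variables (C : numClosedFieldType) (A B : finType).
Implicit Types psi : A * B -> C.

(** Rank at most one, stated entrywise; both converse implications to independence pass through
    it. *)
Definition minors_vanish psi :=
  forall x x' y y', psi (x, y) * psi (x', y') = psi (x, y') * psi (x', y).

Lemma normalized_neq0 psi : normalized psi -> exists x y, psi (x, y) != 0.
Proof.
move=> psi1; have [[x y] p0|all0] := pickP (fun p => psi p != 0).
  by exists x, y.
move: psi1; rewrite /normalized big1 => [|p _].
  by move/esym/eqP; rewrite oner_eq0.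
by apply/eqP; rewrite born_eq0; apply/negbFE/all0.
Qed.

Lemma sum_born_prod psi (a : A -> C) (b : B -> C) :
  (forall x y, psi (x, y) = a x * b y) ->
  \sum_p born psi p = (\sum_x born a x) * (\sum_y born b y).
Proof.
move=> psiE; rewrite mulr_suml.
under [RHS]eq_bigr => x _ do rewrite mulr_sumr.
rewrite pair_bigA; apply: eq_bigr => -[x y] _ /=.
by rewrite /born psiE normrM exprMn.
Qed.

Lemma minors_vanish_independent psi : normalized psi ->
  minors_vanish psi -> potentiality_independent psi.
Proof.
move=> psi1 psi_minors; have [x0 [y0 p0]] := normalized_neq0 psi1.
pose b y := psi (x0, y); pose s := sqrtC (\sum_y born b y).
have S0 : 0 <= \sum_y born b y by apply: sumr_ge0 => y _; apply: born_ge0.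
have s0 : s != 0.
  rewrite sqrtC_eq0; apply: contra p0 => /eqP bs0.
  by apply/eqP/(sum_born_eq0 bs0).
(* Column [y0] times row [x0] over the pivot [psi (x0, y0)] recovers [psi]; the norm [s] of the row
   is moved to [alpha] so that [beta] is normalized. *)
pose alpha x := psi (x, y0) * s / psi (x0, y0); pose beta y := b y / s.
have psiE x y : psi (x, y) = alpha x * beta y.
  apply: (mulIf p0); rewrite psi_minors /alpha /beta /b.
  by field; rewrite s0.
have beta1 : normalized beta.
  rewrite /normalized /born; under eq_bigr => y _ do
    rewrite /beta normrM exprMn normrV ?unitfE // [`|s|]ger0_norm ?sqrtC_ge0 //.
  by rewrite -mulr_suml exprVn sqrtCK divff // -sqrtC_eq0.
exists alpha, beta; split=> //.
(* Total Born weights multiply, so [alpha] inherits its normalization from [psi] and [beta]. *)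
by move: psi1; rewrite /normalized (sum_born_prod psiE) beta1 mulr1.
Qed.

Lemma independent_rank1 psi : normalized psi ->
  potentiality_independent psi -> \rank (state_mx psi) = 1%N.
Proof.
move=> psi1 [a [b [_ _ psiE]]]; apply/eqP; rewrite eqn_leq; apply/andP; split.
  have -> : state_mx psi = (\col_i a (enum_val i)) *m (\row_j b (enum_val j)).
    by apply/matrixP => i j; rewrite !mxE big_ord1 !mxE psiE.
  exact: mulmx_max_rank.
rewrite lt0n mxrank_eq0; have [x [y]] := normalized_neq0 psi1.
apply: contra => /eqP/matrixP/(_ (enum_rank x) (enum_rank y)).
by rewrite !mxE !enum_rankK => ->.
Qed.

Lemma rank1_minors_vanish psi :
  \rank (state_mx psi) = 1%N -> minors_vanish psi.
Proof.
move=> rk1.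
(* At rank one this factorization is a column times a row. *)
have := mulmx_base (state_mx psi).
move: (col_base _) (row_base _); rewrite rk1 => u v /matrixP uv.
have psiE x y : psi (x, y) = u (enum_rank x) 0 * v 0 (enum_rank y).
  have := uv (enum_rank x) (enum_rank y).
  by rewrite !mxE big_ord1 !enum_rankK.
by move=> x x' y y'; rewrite !psiE mulrACA [v _ _ * _]mulrC mulrACA.
Qed.

(** Each factor is transformed by its own kernel and keeps total weight 1, so the marginals are the
    Born weights of the transformed factors. *)
Lemma independent_factorizes psi :
  potentiality_independent psi -> factorizes_in_all_local_contexts psi.
Proof.
move=> [a [b [a1 b1 psiE]]] U V Uu Vu.
set phi := local_transform U V psi.
pose a' x' := \sum_x U x' x * a x; pose b' y' := \sum_y V y' y * b y.
have phiE x y : phi (x, y) = a' x * b' y.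
  rewrite /a' mulr_suml; apply: eq_bigr => x' _.
  rewrite mulr_sumr; apply: eq_bigr => y' _.
  by rewrite psiE mulrACA.
have bornE x y : born phi (x, y) = born a' x * born b' y.
  by rewrite /born phiE normrM exprMn.
have a1' : \sum_x born a' x = 1 by rewrite unitary_kernel_sum_born.
have b1' : \sum_x born b' x = 1 by rewrite unitary_kernel_sum_born.
move=> x y; rewrite /marginalX /marginalY.
under eq_bigr => y' _ do rewrite bornE.
under [X in _ * X]eq_bigr => x' _ do rewrite bornE.
by rewrite -mulr_sumr -mulr_suml a1' b1' mulr1 mul1r.
Qed.

Lemma factorizes_minors_vanish psi :
  factorizes_in_all_local_contexts psi -> minors_vanish psi.
Proof.
move=> fact x x0 y0 y1.
pose u y := (y == y0)%:R * psi (x0, y1) - (y == y1)%:R * psi (x0, y0).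
have [V [c [t1 [Vu uE]]]] := unitary_kernel_with_row u y0.
pose phi := local_transform (fun t t' : A => (t == t')%:R) V psi.
have phiE z t : phi (z, t) = \sum_y V t y * psi (z, y).
  rewrite /phi /local_transform (bigD1 z) //= [X in _ + X]big1 => [|z'].
    by rewrite addr0; apply: eq_bigr => y _; rewrite eqxx mul1r.
  by rewrite eq_sym => /negbTE z'z; rewrite big1 // => y _; rewrite z'z !mul0r.
have sum_delta y' z : \sum_y (y == y')%:R * psi (z, y) = psi (z, y').
  rewrite (bigD1 y') //= eqxx mul1r big1 ?addr0 // => y /negbTE->.
  by rewrite mul0r.
(* Up to sign, the minor on rows [x0], [z] and columns [y0], [y1]. *)
have minorE z : c * phi (z, t1) =
    psi (x0, y1) * psi (z, y0) - psi (x0, y0) * psi (z, y1).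
  rewrite phiE -[in RHS](sum_delta y0 z) -[in RHS](sum_delta y1 z) !mulr_sumr.
  rewrite -sumrB; apply: eq_bigr => y _.
  by rewrite mulrA -uE /u mulrBl !mulrA ![psi (x0, _) * _]mulrC.
suff mx0 : psi (x0, y1) * psi (x, y0) - psi (x0, y0) * psi (x, y1) = 0.
  by move/eqP: mx0; rewrite subr_eq0 mulrC => /eqP ->; rewrite mulrC.
have [c0|c0] := eqVneq c 0; first by rewrite -minorE c0 mul0r.
(* For [z = x0] the two rows of the minor coincide. *)
have phi0 : phi (x0, t1) = 0.
  apply: (mulfI c0); rewrite minorE mulr0 mulrC; apply/eqP.
  by rewrite subr_eq0.
have := fact _ _ (unitary_kernel_id C A) Vu x0 t1; rewrite -/phi.
rewrite {1}/born phi0 normr0 expr0n => /esym/eqP; rewrite mulf_eq0.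
case/orP => /eqP.
  (* Row [x0] of [phi] has weight zero, hence so does row [x0] of [psi], as [V] preserves weight. *)
  rewrite /marginalX; under eq_bigr => t _ do rewrite /born phiE.
  rewrite (unitary_kernel_sum_born (fun y => psi (x0, y)) Vu) => /sum_born_eq0 r0.
  by rewrite !r0 !mul0r subr0.
(* Column [t1] of [phi] vanishes, in particular at row [x]. *)
move=> /(sum_born_eq0 (f := fun z => phi (z, t1)))/(_ x) phix.
by rewrite -minorE phix mulr0.
Qed.

End JointStates.

Theorem theorem1 (R : realType) (A B : finType) (psi : A * B -> R[i]) :
  normalized psi ->
  (potentiality_independent psi <-> factorizes_in_all_local_contexts psi) /\
  (potentiality_independent psi <-> \rank (state_mx psi) = 1%N).
Proof.
move=> psi1; split; split.
- exact: independent_factorizes.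
- by move=> /factorizes_minors_vanish; apply: minors_vanish_independent.
- exact: independent_rank1.
- by move=> /rank1_minors_vanish; apply: minors_vanish_independent.
Qed.
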